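(* For every integer $n\ge 1$, every $n\times n$ tangled grid has at most $11.11^n$ downsets; that is, $TG(n)\le 11.11^n$.
   Context: A chain decomposition of a poset is a partition of its elements into pairwise disjoint chains. A poset $P$ is an $n\times n$ tangled grid if $P$ has two chain decompositions, each consisting of $n$ chains, whose members are called m-chains and w-chains respectively, such that each m-chain and each w-chain intersect each other in exactly one element. (In particular $P$ has $n^2$ elements and every m-chain and w-chain has $n$ elements.) The poset may have further order relations besides those implied by the chains. A downset of a poset is a subset that contains, with each of its elements, all smaller elements of the poset. $TG(n)$ is the maximum number of downsets in an $n\times n$ tangled grid. *)

(* Defs.v *)
From mathcomp Require Import all_boot all_order all_algebra.

Set Implicit Arguments.
Unset Strict Implicit.
Unset Printing Implicit Defensive.

Import Order.TTheory.
Local Open Scope order_scope.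

Definition is_chain (d : Order.disp_t) (P : finPOrderType d) (C : {set P})
    : bool :=
  [forall x in C, forall y in C, x >=< y].

(* [partition] also asks for nonempty blocks, and #|D| counts distinct chains.
   In a tangled grid with n >= 1 every chain meets a chain of the other
   decomposition, so that nonemptiness is no extra requirement there. *)
Definition is_chain_decomposition (d : Order.disp_t) (P : finPOrderType d)
    (D : {set {set P}}) : Prop :=
  partition D [set: P] /\ (forall C : {set P}, C \in D -> is_chain C).

(* M is the set of m-chains and W the set of w-chains. *)
Definition tangled_grid (n : nat) (d : Order.disp_t) (P : finPOrderType d)
    : Prop :=
  exists M W : {set {set P}},
    [/\ is_chain_decomposition M, is_chain_decomposition W,
        #|M| = n, #|W| = n
      & forall A B : {set P}, A \in M -> B \in W -> #|A :&: B| = 1%N].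

Definition is_downset (d : Order.disp_t) (P : finPOrderType d) (D : {set P})
    : bool :=
  [forall x in D, forall y, (y <= x) ==> (y \in D)].

Definition downsets (d : Order.disp_t) (P : finPOrderType d) : {set {set P}} :=
  [set D : {set P} | is_downset D].

(* [is_TG n k] says that TG(n) = k: the maximum ranges over all finite posets,
   so it is given by its graph; k is unique by antisymmetry. *)
Definition is_TG (n k : nat) : Prop :=
  (exists (d : Order.disp_t) (P : finPOrderType d),
      tangled_grid n P /\ #|downsets P| = k) /\
  (forall (d : Order.disp_t) (P : finPOrderType d),
      tangled_grid n P -> (#|downsets P| <= k)%N).

(* Main.v *)
Require Import Defs.
From Stdlib Require Import Classical_Prop.
From mathcomp Require Import all_boot all_order all_algebra.
From mathcomp Require Import fingroup perm.
Import Order.TTheory GRing.Theory Num.Theory.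
Local Open Scope ring_scope.

(** An n x n tangled grid has at most C(3n, n) <= 8^n downsets.

Write g i j for the common element of the i-th m-chain and the j-th w-chain.
Reveal a downset D one m-chain at a time, in an order s. Before step k, an
element x of the chain s k is known to be in D if an element of D above x on
the w-chain of x has been revealed, and known to be outside D if an element
outside D below x on that w-chain has been revealed. Only the other elements
are undetermined, and since D meets the chain s k in an initial segment, at
most 1 + u_k traces are possible there, where u_k is the number of
undetermined elements ([card_trace_le]). The product over k of the inverses of
the true numbers of options is the probability of reaching D by choosing
uniformly among the options at each step, so its sum over all D is at most 1
([kraft]).

Now let s be uniformly random and fix D. On a given w-chain, the element
revealed at step k is undetermined only if it is a record: the topmost element
of D revealed so far on that w-chain, or the lowest one outside D. By symmetry
each of the two events has probability at most 1/(k+1) when k steps precede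
([record_rare]). Hence u_k has mean at most 2n/(k+1), and 1 + u_k has mean at
most a_k = 1 + 2n/(k+1). By the arithmetic-geometric mean inequality, in the
form [AGM_tangent], the mean of the product of the 1/(1 + u_k) is at least the
product of the 1/a_k, which is 1/C(3n, n) by [prod_bin]. Summing over D and
averaging over s gives the bound ([card_downsets_le_bin]).

The maximum TG(n) then exists since a bounded nonempty set of naturals has a
largest element; a total order on n^2 elements shows that it is nonempty. *)

(** * Records of a random permutation *)

(** The permutation s is read as an order of revelation, s 0 first, and R x y as
    y being at or above x; the record is a strict running maximum among the
    indices that satisfy a. *)
Definition record_at {n : nat} (a : pred 'I_n) (R : rel 'I_n)
    (s : {perm 'I_n}) (k : 'I_n) : bool :=
  a (s k) && [forall l : 'I_n, (l < k)%N ==> ~~ (a (s l) && R (s k) (s l))].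

(** Among the indices s 0, ..., s k at most one satisfies a and is R-above all
    the others that do, by totality. Each of these k + 1 times is equally likely
    to carry it, because composing with a transposition of times m and k
    exchanges the two events. *)
Lemma record_rare (n : nat) (a : pred 'I_n) (R : rel 'I_n) (k : 'I_n) :
  total R ->
  ((\sum_(s : {perm 'I_n}) record_at a R s k) * k.+1 <= n`!)%N.
Proof.
move=> Rtot.
pose top (s : {perm 'I_n}) (m : 'I_n) := a (s m) &&
  [forall l : 'I_n, ((l <= k) && (l != m))%N ==> ~~ (a (s l) && R (s m) (s l))].
have topE (m : 'I_n) : (m <= k)%N ->
    (\sum_s record_at a R s k = \sum_s top s m)%N.
  move=> lemk; rewrite (reindex_inj (mulgI (tperm m k))) /=.
  apply: eq_bigr => s _; congr (nat_of_bool _).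
  rewrite /record_at /top permM tpermR; congr (_ && _).
  apply/forallP/forallP => H l; apply/implyP.
    case/andP=> lelk nlm.
    have := H (tperm m k l); rewrite permM tpermK => /implyP.
    apply; case: tpermP => [e|e|_ /eqP nlk].
    - by rewrite e eqxx in nlm.
    - by rewrite e eq_sym in nlm *; rewrite ltn_neqAle nlm lemk.
    - by rewrite ltn_neqAle lelk andbT.
  move=> ltlk; rewrite permM.
  have /implyP := H (tperm m k l); apply.
  case: tpermP => [e|e|/eqP nlm /eqP nlk].
  - by rewrite leqnn -e; apply/negP => /eqP e'; rewrite e' ltnn in ltlk.
  - by rewrite e ltnn in ltlk.
  - by rewrite nlm (ltnW ltlk).
(* Both factors become sums of ones, so that the claim reduces to: for each s
   at most one m <= k is on top. *)
have -> : (n`! = \sum_(s : {perm 'I_n}) 1)%N.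
  by rewrite sum1_card card_Sn.
have -> : (k.+1 = \sum_(m < n | m <= k) 1)%N.
  by rewrite -(big_ord_widen n (fun=> 1%N) (ltn_ord k)) sum1_card card_ord.
rewrite big_distrr /=.
under eq_bigr => m lemk do rewrite muln1 (topE m lemk).
rewrite exchange_big /=; apply: leq_sum => s _.
case: (pickP [pred m : 'I_n | (m <= k)%N && top s m]) => [m /andP[lemk tm]|none].
  rewrite (bigD1 m) //= big1 ?addn0 ?leq_b1 // => m' /andP[lem'k nm'm].
  apply/eqP; rewrite eqb0; apply/negP => /andP[am' /forallP tm'].
  case/andP: tm => am /forallP tm.
  have := tm' m; have := tm m'; rewrite lemk lem'k nm'm eq_sym nm'm am am' /=.
  by case/orP: (Rtot (s m) (s m')) => ->.
rewrite big1 // => m lemk; have := none m => /=; rewrite lemk /= => -> //.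
Qed.

(** * Counting by successive revelation *)

(** A Kraft inequality. Reveal X 0, X 1, ... one after the other, each time
    choosing uniformly among the values that still occur in F; the product is
    the probability of ending at D. The induction removes X 0 and replaces F by
    its fibres under X 0. *)
Lemma kraft (n : nat) (T U : finType) (X : 'I_n -> T -> U) (F : {set T}) :
  {in F &, forall D E, (forall k, X k D = X k E) -> D = E} ->
  \sum_(D in F) \prod_(k < n)
     (#|X k @: [set E in F | [forall l : 'I_n, (l < k)%N ==> (X l E == X l D)]]|
        %:R : rat)^-1 <= 1.
Proof.
elim: n X F => [|n IHn] X F Xinj.
  under eq_bigr do rewrite big_ord0.
  rewrite sumr_const (ler_nat _ _ 1).
  by apply/card_le1_eqP => D E DF EF; apply: Xinj => // -[].
set V := X ord0 @: F.
rewrite (partition_big (X ord0) (mem V)) /=; last by move=> D; apply: imset_f.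
pose G v := [set D in F | X ord0 D == v].
have step v : v \in V -> \sum_(D in F | X ord0 D == v) \prod_(k < n.+1)
     (#|X k @: [set E in F | [forall l : 'I_n.+1,
        (l < k)%N ==> (X l E == X l D)]]|%:R : rat)^-1 <= #|V|%:R^-1.
  move=> vV.
  pose S := \sum_(D in G v) \prod_(k < n)
     (#|X (lift ord0 k) @: [set E in G v | [forall l : 'I_n,
        (l < k)%N ==> (X (lift ord0 l) E == X (lift ord0 l) D)]]|%:R : rat)^-1.
  suff -> : \sum_(D in F | X ord0 D == v) \prod_(k < n.+1)
     (#|X k @: [set E in F | [forall l : 'I_n.+1,
        (l < k)%N ==> (X l E == X l D)]]|%:R : rat)^-1 = #|V|%:R^-1 * S.
    rewrite ler_piMr ?invr_ge0 //.
    apply: (IHn (fun k => X (lift ord0 k))) => D E.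
    rewrite !inE => /andP[DF /eqP Dv] /andP[EF /eqP Ev] DE.
    apply: Xinj => // k; case: (unliftP ord0 k) => [k'|] -> //.
    by rewrite Dv Ev.
  rewrite /S mulr_sumr; apply: eq_big => [D|D /andP[DF /eqP Dv]].
    by rewrite inE.
  have F0 : [set E in F | [forall l : 'I_n.+1,
      (l < @ord0 n)%N ==> (X l E == X l D)]] = F.
    apply/setP => E; rewrite inE.
    by case: (E \in F) => //=; apply/forallP.
  rewrite big_ord_recl F0; congr (_ * _); apply: eq_bigr => k _.
  suff -> : [set E in F | [forall l : 'I_n.+1,
      (l < lift ord0 k)%N ==> (X l E == X l D)]] = [set E in G v |
      [forall l : 'I_n, (l < k)%N ==> (X (lift ord0 l) E == X (lift ord0 l) D)]].
    by [].
  apply/setP => E; rewrite !inE -andbA.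
  case: (E \in F) => //=; apply/forallP/andP => [H|[/eqP E0 /forallP H] l].
    split; first by have := H ord0; rewrite Dv.
    by apply/forallP => l; have := H (lift ord0 l).
  case: (unliftP ord0 l) => [l'|] -> ; first exact: H.
  by rewrite E0 Dv eqxx implybT.
apply: (@le_trans _ _ (\sum_(v in V) #|V|%:R^-1)); first exact: ler_sum.
rewrite sumr_const -[X in X <= _]mulr_natr.
have [->|nz] := eqVneq (#|V|%:R : rat) 0; first by rewrite mulr0.
by rewrite mulVf.
Qed.

(** * Numerical inequalities *)

(** The arithmetic-geometric mean inequality for y_0, ..., y_(n-1) and
    z = 1 + sum (1 - y_k): these n + 1 numbers have mean 1, so their product is
    at most 1. If z is negative there is nothing to prove. This replaces the
    convexity of exp in averaging a product: the left side is affine in y. *)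
Lemma AGM_tangent (n : nat) (y : 'I_n -> rat) :
  (forall k, 0 < y k) ->
  1 + \sum_(k < n) (1 - y k) <= \prod_(k < n) (y k)^-1.
Proof.
move=> y_gt0; set z := 1 + _.
have P_gt0 : 0 < \prod_(k < n) y k by apply: prodr_gt0.
rewrite prodfV -[X in _ <= X]div1r ler_pdivlMr //.
have [z_ge0|z_lt0] := leP 0 z; last first.
  by apply: le_trans ler01; rewrite nmulr_rle0 // ltW.
pose E (i : 'I_n.+1) := oapp y z (unlift ord0 i).
have := @leif_AGM rat 'I_n.+1 predT E.
case.
  move=> i _; rewrite /E; case: (unlift _ _) => //= k; exact: ltW.
move=> + _; rewrite card_ord !big_ord_recl /E unlift_none /=.
under eq_bigr do rewrite liftK /=.
under [in X in _ <= X ^+ _]eq_bigr do rewrite liftK /=.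
move=> h; apply: (le_trans h).
rewrite /z sumrB sumr_const card_ord -addrA subrK.
by rewrite -[1 + n%:R]/(1%:R + n%:R) -natrD add1n divff ?expr1n // pnatr_eq0.
Qed.

Lemma prod_bin (m n : nat) :
  \prod_(k < n) (1 + m%:R / k.+1%:R) = 'C(m + n, n)%:R :> rat.
Proof.
elim: n => [|n IHn]; first by rewrite big_ord0 bin0.
rewrite big_ord_recr /= IHn.
have nz : (n.+1%:R : rat) != 0 by rewrite pnatr_eq0.
apply: (mulIf nz); rewrite -mulrA mulrDl mul1r divfK // -!natrD -!natrM.
by rewrite mulnC [(n.+1 + m)%N]addnC addnS mul_bin_diag mulnC.
Qed.

Lemma bin_le_exp2 (m k : nat) : ('C(m, k) <= 2 ^ m)%N.
Proof.
by rewrite -[m in 'C(m, _)]card_ord -card_draws -[m in (2 ^ m)%N]card_ord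
  -cardsT -card_powerset subset_leq_card // powersetT subsetT.
Qed.

(** * Coordinates on a tangled grid *)

Lemma grid_coordinates (n : nat) (d : Order.disp_t) (P : finPOrderType d) :
  tangled_grid n P ->
  exists g : 'I_n -> 'I_n -> P,
    [/\ forall p, exists i j, p = g i j,
        forall i j j', (g i j >=< g i j')%O
      & forall i i' j, (g i j >=< g i' j)%O].
Proof.
case=> M [W [[Mpart Mch] [Wpart Wch] cM cW MW]].
case: n / cM cW => cW.
pose A (i : 'I_#|M|) := enum_val i.
pose B (j : 'I_#|M|) := enum_val (cast_ord (esym cW) j).
have AM i : A i \in M by apply: enum_valP.
have BW j : B j \in W by apply: enum_valP.
have ex i j : exists x, x \in A i :&: B j.
  by apply/set0Pn; rewrite -card_gt0 MW.
pose g i j := xchoose (ex i j).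
have gP i j : g i j \in A i :&: B j by apply: xchooseP.
have gA i j : g i j \in A i by have /setIP[] := gP i j.
have gB i j : g i j \in B j by have /setIP[] := gP i j.
exists g; split=> [p|i j j'|i i' j].
- have /bigcupP[C CM pC] : p \in cover M by rewrite (cover_partition Mpart).
  have /bigcupP[C' CW pC'] : p \in cover W by rewrite (cover_partition Wpart).
  exists (enum_rank_in CM C), (cast_ord cW (enum_rank_in CW C')).
  set i := enum_rank_in _ _; set j := cast_ord _ _.
  have AE : A i = C by rewrite /A enum_rankK_in.
  have BE : B j = C' by rewrite /B cast_ordK enum_rankK_in.
  have /eqP/cards1P[x xE] := MW _ _ (AM i) (BW j).
  have := gP i j; rewrite xE => /set1P->.
  by apply/set1P; rewrite -xE AE BE inE pC.
- by have /forall_inP/(_ _ (gA i j))/forall_inP/(_ _ (gA i j')) := Mch _ (AM i).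
- by have /forall_inP/(_ _ (gB i j))/forall_inP/(_ _ (gB i' j)) := Wch _ (BW j).
Qed.

(** * Existence of the maximum *)

(** In a total order every set is a chain, so the rows and the columns of the
    square are chain decompositions. *)
Lemma total_grid (n : nat) : tangled_grid n ('I_n *l 'I_n)%type.
Proof.
pose T := ('I_n *l 'I_n)%type.
have lines (f : T -> 'I_n) (h : 'I_n -> T) : cancel h f ->
    let D := [set [set p : T | f p == i] | i : 'I_n] in
    is_chain_decomposition D /\ #|D| = n.
  move=> hK D; split; last first.
    rewrite card_imset ?card_ord // => i j /setP/(_ (h i)).
    by rewrite !inE hK eqxx => /esym/eqP.
  split=> [|C _]; last first.
    by apply/forall_inP => x _; apply/forall_inP => y _; apply: comparableT.
  apply/and3P; split.
  - rewrite eqEsubset subsetT; apply/subsetP => p _; apply/bigcupP.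
    by exists [set q | f q == f p]; rewrite ?inE //; apply: imset_f.
  - apply/trivIsetP => _ _ /imsetP[i _ ->] /imsetP[j _ ->] ij.
    rewrite -setI_eq0; apply: contraNT ij => /set0Pn[p].
    by rewrite !inE => /andP[/eqP <- /eqP <-].
  - apply/imsetP => -[i _ /setP/(_ (h i))].
    by rewrite !inE hK eqxx.
have [D1 c1] := lines fst (fun i => (i, i)) (fun=> erefl).
have [D2 c2] := lines snd (fun i => (i, i)) (fun=> erefl).
do 2 eexists; split; [exact: D1|exact: D2|exact: c1|exact: c2|].
move=> _ _ /imsetP[i _ ->] /imsetP[j _ ->]; apply/eqP/cards1P.
exists ((i, j) : T); apply/setP => -[x y].
by rewrite !inE.
Qed.

(** Excluded middle decides, for each candidate from b downwards, whether some
    grid attains it; this is a statement about all finite posets. *)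
Lemma TG_exists (n b : nat) :
  (forall (d : Order.disp_t) (P : finPOrderType d),
     tangled_grid n P -> (#|downsets P| <= b)%N) ->
  exists2 k, is_TG n k & (k <= b)%N.
Proof.
elim: b => [|b IHb] bound.
  exists 0%N => //; split=> //; exists _, ('I_n *l 'I_n)%type.
  split; first exact: total_grid.
  by apply/eqP; rewrite -leqn0; apply/bound/total_grid.
have [[d [P [tgP cP]]]|none] := classic (exists (d : Order.disp_t)
    (P : finPOrderType d), tangled_grid n P /\ #|downsets P| = b.+1).
  by exists b.+1 => //; split=> //; exists d, P.
have [d P tgP|k TGk lekb] := IHb; last by exists k => //; apply: leqW.
rewrite -ltnS ltn_neqAle bound // andbT; apply/eqP => cP.
by apply: none; exists d, P.
Qed.

(** * Revealing a downset chain by chain *)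

Definition trace {n : nat} {d : Order.disp_t} {P : finPOrderType d}
    (g : 'I_n -> 'I_n -> P) (i : 'I_n) (D : {set P}) : {set 'I_n} :=
  [set j | g i j \in D].

(** The positions j on the m-chain s k where membership in D does not follow
    from the traces on s 0, ..., s (k-1) along the w-chain j. For an element of
    D this means that it is above all elements of D revealed on that w-chain,
    and dually for an element outside D. *)
Definition undetermined {n : nat} {d : Order.disp_t} {P : finPOrderType d}
    (g : 'I_n -> 'I_n -> P) (D : {set P}) (s : {perm 'I_n}) (k : 'I_n) :
    {set 'I_n} :=
  [set j | record_at (fun i => g i j \in D)
             (fun i i' => (g i j <= g i' j)%O) s k
        || record_at (fun i => g i j \notin D)
             (fun i i' => (g i' j <= g i j)%O) s k].

(** All members of F agree with D at the determined positions. Their traces on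
    an m-chain are nested, being initial segments of a chain, so a trace is
    fixed by its number of undetermined positions. *)
Lemma card_trace_le (n : nat) (d : Order.disp_t) (P : finPOrderType d)
    (g : 'I_n -> 'I_n -> P) (D : {set P}) (s : {perm 'I_n}) (k : 'I_n)
    (F : {set {set P}}) :
  (forall i j j', (g i j >=< g i j')%O) ->
  {in F, forall E, is_downset E /\
     forall l : 'I_n, (l < k)%N -> trace g (s l) E = trace g (s l) D} ->
  (#|trace g (s k) @: F| <= #|undetermined g D s k|.+1)%N.
Proof.
move=> gcmp FP; set U := undetermined g D s k; set i := s k.
have down E x y : E \in F -> x \in E -> (y <= x)%O -> y \in E.
  by move=> /FP[/forall_inP Ed _] /Ed/forallP/(_ y)/implyP; apply.
have old E (l : 'I_n) j : E \in F -> (l < k)%N -> (g (s l) j \in E) = (g (s l) j \in D).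
  by move=> /FP[_ H] /H/setP/(_ j); rewrite !inE.
have det E j : E \in F -> j \notin U -> (g i j \in E) = (g i j \in D).
  move=> EF; rewrite inE negb_or /record_at -/i.
  case: (boolP (g i j \in D)) => /= gD.
    rewrite andbT => /forallPn[l]; rewrite negb_imply negbK.
    by case/and3P=> lk lD /(down E _ _ EF) ->; rewrite ?old.
  case/forallPn=> l; rewrite negb_imply negbK => /and3P[lk lD le].
  apply: contraNF lD => /(down E _ _ EF)/(_ le); by rewrite old.
have nested E E' : E \in F -> E' \in F ->
    (trace g i E \subset trace g i E') || (trace g i E' \subset trace g i E).
  move=> EF E'F; case: (boolP (_ \subset _)) => //= /subsetPn[j].
  rewrite !inE => jE jE'; apply/subsetP => j'; rewrite !inE => j'E'.
  case/orP: (gcmp i j j') => [/(down E' _ _ E'F j'E')|/(down E _ _ EF jE) //].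
  by rewrite (negPf jE').
pose size_in (A : {set 'I_n}) : 'I_#|U|.+1 := inord #|A :&: U|.
have size_inj : {in trace g i @: F &, injective size_in}.
  have sub E E' : E \in F -> E' \in F -> #|trace g i E :&: U| = #|trace g i E' :&: U| ->
      trace g i E \subset trace g i E' -> trace g i E = trace g i E'.
    move=> EF E'F eqc EE'.
    have /eqP/setP eqU : trace g i E :&: U == trace g i E' :&: U.
      by rewrite eqEcard setSI //= eqc.
    apply/setP => j; have := eqU j; rewrite !in_setI.
    case: (boolP (j \in U)) => [_|jU _]; rewrite ?andbT //.
    by rewrite !in_set !det.
  move=> _ _ /imsetP[E EF ->] /imsetP[E' E'F ->] /(congr1 val) /=.
  rewrite !inordK ?ltnS ?subset_leq_card ?subsetIr // => eqc.
  by case/orP: (nested E E' EF E'F) => /sub ->.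
by rewrite -(card_in_imset size_inj) -[X in (_ <= X)%N]card_ord max_card.
Qed.

(** Each of the n w-chains contributes at most two kinds of records, one among
    the elements of D and one, for the dual order, among the others. *)
Lemma sum_undetermined_le (n : nat) (d : Order.disp_t) (P : finPOrderType d)
    (g : 'I_n -> 'I_n -> P) (D : {set P}) (k : 'I_n) :
  (forall i i' j, (g i j >=< g i' j)%O) ->
  ((\sum_(s : {perm 'I_n}) #|undetermined g D s k|) * k.+1 <= 2 * n * n`!)%N.
Proof.
move=> gcmp.
pose inD j s := record_at (fun i => g i j \in D)
  (fun i i' => (g i j <= g i' j)%O) s k.
pose outD j s := record_at (fun i => g i j \notin D)
  (fun i i' => (g i' j <= g i j)%O) s k.
have le1 s : (#|undetermined g D s k| <= \sum_j (inD j s + outD j s))%N.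
  rewrite -sum1_card big_mkcond /=; apply: leq_sum => j _.
  by rewrite inE -/(inD j s) -/(outD j s); case: (inD j s); case: (outD j s).
apply: (@leq_trans ((\sum_j \sum_s (inD j s + outD j s)) * k.+1)%N).
  by rewrite leq_mul2r exchange_big leq_sum.
have -> : (2 * n * n`! = \sum_(j < n) (n`! + n`!))%N.
  by rewrite sum_nat_const card_ord addnn -mul2n mulnA [(2 * n)%N]mulnC.
rewrite big_distrl; apply: leq_sum => j _ /=.
rewrite big_split mulnDl; apply: leq_add; apply: record_rare => i i' /=.
  exact: gcmp.
exact: gcmp.
Qed.

(** With a_k = 1 + 2n/(k+1), the ratios (1 + u_k)/a_k have mean at most 1 over
    s, so the lower bound of [AGM_tangent] applied to them has mean at least 1;
    the product of the a_k is the binomial coefficient. *)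
Lemma downset_weight_ge (n : nat) (d : Order.disp_t) (P : finPOrderType d)
    (g : 'I_n -> 'I_n -> P) (D : {set P}) :
  (forall i i' j, (g i j >=< g i' j)%O) ->
  n`!%:R / 'C(2 * n + n, n)%:R <=
  \sum_(s : {perm 'I_n}) \prod_(k < n) #|undetermined g D s k|.+1%:R^-1 :> rat.
Proof.
move=> gcmp; pose a (k : 'I_n) : rat := 1 + (2 * n)%:R / k.+1%:R.
have a_gt0 k : 0 < a k by rewrite ltr_pwDl ?divr_ge0.
have pa_gt0 : 0 < \prod_k a k by rewrite prodr_gt0.
rewrite -prod_bin -/a ler_pdivrMr //.
pose y s k := #|undetermined g D s k|.+1%:R / a k.
apply: (@le_trans _ _ (\sum_(s : {perm 'I_n}) (1 + \sum_k (1 - y s k)))).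
  rewrite big_split /= sumr_const card_Sn lerDl exchange_big /=.
  apply: sumr_ge0 => k _.
  rewrite sumrB sumr_const card_Sn subr_ge0 -mulr_suml ler_pdivrMr //.
  under eq_bigr do rewrite -add1n natrD.
  rewrite big_split /= sumr_const card_Sn mulrDr mulr1 lerD2l.
  rewrite mulrA ler_pdivlMr ?ltr0n // -natr_sum -!natrM ler_nat.
  by rewrite [(n`! * _)%N]mulnC sum_undetermined_le.
rewrite mulr_suml; apply: ler_sum => s _.
apply: le_trans (AGM_tangent _ (y s) _) _ => [k|].
  by rewrite divr_gt0 // ltr0n.
rewrite -big_split /=; under eq_bigr do rewrite invf_div mulrC.
exact: lexx.
Qed.

(** * The bound *)

(** Double counting of the weights of pairs (D, s): at least n!/C(3n, n) for
    each D, and at most 1 for each s. *)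
Lemma card_downsets_le_bin (n : nat) (d : Order.disp_t) (P : finPOrderType d) :
  tangled_grid n P -> (#|downsets P| <= 'C(2 * n + n, n))%N.
Proof.
case/grid_coordinates=> g [gsurj grow gcol].
have bin_pos : 0 < 'C(2 * n + n, n)%:R :> rat by rewrite ltr0n bin_gt0 leq_addl.
have fact_pos : 0 < n`!%:R :> rat by rewrite ltr0n fact_gt0.
rewrite -(ler_nat rat) -(ler_pM2l fact_pos) -ler_pdivrMr //.
pose w D (s : {perm 'I_n}) : rat :=
  \prod_(k < n) #|undetermined g D s k|.+1%:R^-1.
apply: (@le_trans _ _ (\sum_(D in downsets P) \sum_s w D s)).
  rewrite mulrAC mulr_natr -sumr_const; apply: ler_sum => D _.
  exact: downset_weight_ge.
rewrite exchange_big /=.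
have -> : n`!%:R = \sum_(s : {perm 'I_n}) 1 :> rat by rewrite sumr_const card_Sn.
apply: ler_sum => s _.
apply: le_trans (kraft n _ _ (fun k => trace g (s k)) (downsets P) _).
  apply: ler_sum => D Ddown; apply: ler_prod => k _.
  rewrite invr_ge0 ler0n lef_pV2 ?posrE ?ltr0n // ?ler_nat; last first.
    rewrite card_gt0; apply/set0Pn; exists (trace g (s k) D); apply: imset_f.
    by rewrite inE Ddown; apply/forallP => l; rewrite eqxx implybT.
  apply: card_trace_le => // E; rewrite !inE => /andP[Ed /forallP H].
  by split=> // l lk; apply/eqP; have := H l; rewrite lk.
move=> D E _ _ DE; apply/setP => p; have [i [j ->]] := gsurj p.
by have /setP/(_ j) := DE (s^-1%g i); rewrite permKV !inE.
Qed.

Theorem mainTheorem4 (n : nat) (hn : (1 <= n)%N) :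
  (forall (d : Order.disp_t) (P : finPOrderType d), tangled_grid n P ->
     (#|downsets P|%:R : rat) <= (1111%:R / 100%:R) ^+ n) /\
  (exists k : nat, is_TG n k /\ (k%:R : rat) <= (1111%:R / 100%:R) ^+ n).
Proof.
have bound d P (tgP : @tangled_grid n d P) : (#|downsets P| <= 8 ^ n)%N.
  apply: leq_trans (card_downsets_le_bin n d P tgP) _.
  apply: leq_trans (bin_le_exp2 _ _) _.
  by rewrite addnC -mulSn expnM leqnn.
(* Stated for variables, since unification on the numerals would compute with
   the rational 1111/100. *)
have le_frac (a b c : nat) : (0 < b)%N -> (c * b <= a)%N ->
    c%:R ^+ n <= (a%:R / b%:R) ^+ n :> rat.
  move=> b_gt0 le_cb_a; apply: lerXn2r.
  - by rewrite nnegrE ler0n.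
  - by rewrite nnegrE divr_ge0 ?ler0n.
  - by rewrite ler_pdivlMr ?ltr0n // -natrM ler_nat.
have le8 k : (k <= 8 ^ n)%N -> (k%:R : rat) <= (1111%:R / 100%:R) ^+ n.
  rewrite -(ler_nat rat) natrX => /le_trans; apply.
  exact: (le_frac 1111 100 8).
split=> [d P tgP|]; first exact/le8/bound.
have [k TGk lek] := TG_exists n (8 ^ n) bound.
by exists k; split; [exact: TGk | exact: le8].
Qed.
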